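(* Let $X_1,X_2,X_3$ be linear vector fields on $\mathbb{C}^n$, pairwise distinct and not identically zero, which satisfy the barycentric property. Then, identifying each $X_i$ with its matrix, the $X_i$ are up to (simultaneous) conjugacy contained in the Heisenberg Lie algebra $\mathfrak{h}_n$; that is, there is $g\in\mathrm{GL}(n,\mathbb{C})$ such that $gX_ig^{-1}\in\mathfrak{h}_n$ for $i=1,2,3$.
   Context: A linear vector field on $\mathbb{C}^n$ is a vector field $X(x)=Ax$ with $A$ an $n\times n$ complex matrix, and it is identified with $A$. $\exp(tX)$ denotes the flow of $X$. Vector fields $X_1,\dots,X_p$ satisfy the barycentric property if $\sum_{k=1}^p X_k(\exp(tX_k)(x))=0$ for all $x$ and all small $t\in\mathbb C$; equivalently $\sum_{k=1}^p\exp(tX_k)(x)=p\,x$. $\mathfrak{h}_n\subset\mathrm{gl}(n,\mathbb{C})$ denotes the Lie algebra of strictly upper triangular $n\times n$ matrices (called the Heisenberg Lie algebra in the paper). *)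

(* Defs.v *)
From HB Require Import structures.
From mathcomp Require Import all_boot all_order all_algebra.
From mathcomp Require Import complex.
From mathcomp Require Import all_classical all_reals all_analysis.

Set Implicit Arguments.
Unset Strict Implicit.
Unset Printing Implicit Defensive.

Import Order.TTheory GRing.Theory Num.Theory.
Import numFieldNormedType.Exports.

Local Open Scope classical_set_scope.
Local Open Scope ring_scope.

(* [phi t x] stands for exp(tX)(x), with X an autonomous vector field and t a
   scalar of K, so that for K = R[i] the derivative below is the complex one.
   The flow is local: the set of times on which t |-> phi t x is required to
   be an integral curve of X is a neighborhood of 0 that may depend on x, and
   the values of phi elsewhere are irrelevant. *)
Definition is_flow (K : numFieldType) (n : nat)
    (X : 'cV[K]_n -> 'cV[K]_n) (phi : K -> 'cV[K]_n -> 'cV[K]_n) : Prop :=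
  forall x : 'cV[K]_n,
    phi 0 x = x /\ \forall t \near (0 : K), is_derive t (1 : K) (phi^~ x) (X (phi t x)).

(* For K = R[i], the germ at t = 0 of the flow of a holomorphic vector field
   exists and is unique, so the existential quantifier merely names the flows
   of the X k. *)
Definition barycentric (K : numFieldType) (n p : nat)
    (X : 'I_p -> 'cV[K]_n -> 'cV[K]_n) : Prop :=
  exists phi : 'I_p -> K -> 'cV[K]_n -> 'cV[K]_n,
    (forall k, is_flow (X k) (phi k)) /\
    (forall x : 'cV[K]_n,
       \forall t \near (0 : K), \sum_(k < p) X k (phi k t x) = 0).

Definition linear_field (K : numFieldType) (n : nat) (A : 'M[K]_n) :
    'cV[K]_n -> 'cV[K]_n :=
  fun x => A *m x.

Definition heisenberg (K : numFieldType) (n : nat) : set 'M[K]_n :=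
  [set M | forall i j : 'I_n, (j <= i)%N -> M i j = 0].

(* Main.v *)
(* Differentiating the barycentric identity repeatedly at t = 0 shows that all
   the power sums \sum_k A_k^m with m >= 1 vanish. For three matrices, m <= 3
   already suffices: the two nontrivial components U and V of the Fourier
   transform of (A_0, A_1, A_2) over Z/3 anticommute and satisfy U^3 = V^3
   (after rescaling), so U^3 V = V^4 while U^3 anticommutes with V, whence
   U^4 = V^4 = 0. Anticommuting nilpotent matrices have a common kernel vector,
   because each preserves the kernel of the other, and induction on the
   dimension makes them simultaneously strictly upper triangular; the A_k are
   linear combinations of U and V. *)
Require Import Defs.
From mathcomp Require Import all_boot all_order all_algebra.
From mathcomp Require Import complex ring.
From mathcomp Require Import all_classical all_reals all_analysis.

Set Implicit Arguments.
Unset Strict Implicit.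
Unset Printing Implicit Defensive.

Import Order.TTheory GRing.Theory Num.Theory.
Import numFieldNormedType.Exports.
Local Open Scope classical_set_scope.
Local Open Scope ring_scope.
Local Open Scope complex_scope.

Lemma is_derive_coord (K : numFieldType) (V : normedModType K) (m n : nat)
    (f : V -> 'M[K]_(m, n)) (x v : V) (df : 'M[K]_(m, n)) (i : 'I_m) (j : 'I_n) :
  is_derive x v f df ->
  is_derive x v (fun y => f y i j : K^o) (df i j).
Proof.
move=> [/cvg_ex[l fl] <-].
have -> : 'D_v f x = l by apply: cvg_lim fl.
have fij : (fun h : K => h^-1 *: ((fun y => f y i j : K^o) (h *: v + x) - f x i j))
    @ 0^' --> (l i j : K^o).
  have := cvg_comp _ _ fl (@coord_continuous K m n i j l).
  rewrite (_ : _ \o _ = fun h : K =>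
    h^-1 *: ((fun y => f y i j : K^o) (h *: v + x) - f x i j)) //.
  by apply/funext => h /=; rewrite !mxE.
by split; [apply/cvg_ex; exists (l i j) | apply: cvg_lim fij].
Qed.

Lemma is_derive_mulmx (K : numFieldType) (V : normedModType K) (m n : nat)
    (B : 'M[K]_(m, n)) (f : V -> 'cV[K]_n) (x v : V) (df : 'cV[K]_n) (i : 'I_m) :
  is_derive x v f df ->
  is_derive x v (fun y => (B *m f y) i 0 : K^o) ((B *m df) i 0).
Proof.
move=> fdf; rewrite mxE.
rewrite (_ : (fun y => _) = \sum_(j < n) (B i j \*: (fun y => f y j 0 : K^o))).
  by apply: is_derive_sum => j; apply: is_deriveZ; apply: is_derive_coord.
by apply/funext => y; rewrite fct_sumE mxE.
Qed.

(** Along the flow, [phi k t x] has derivative [A k *m phi k t x], so differentiating the identity,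
    kept for all [t] near 0, raises the exponent by one. Taking [t = 0] and basis vectors [x]
    returns to matrices. *)
Lemma barycentric_linear_power_sum (K : numFieldType) (n p : nat)
    (A : 'I_p -> 'M[K]_n) (m : nat) :
  barycentric (fun k => linear_field (A k)) -> \sum_(k < p) A k ^+ m.+1 = 0.
Proof.
case=> phi [flow bary].
suff near0 x : \forall t \near (0 : K),
    \sum_(k < p) A k ^+ m.+1 *m phi k t x = 0.
  apply/row_matrixP => i; apply/rowP => j; rewrite row0 !mxE.
  have /matrixP/(_ i 0) := nbhs_singleton (near0 (delta_mx j 0)).
  rewrite (eq_bigr (fun k => A k ^+ m.+1 *m delta_mx j 0)); last first.
    by move=> k _; rewrite (flow k _).1.
  by rewrite -mulmx_suml -colE !mxE.
elim: m => [|m IHm].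
  by apply: filterS (bary x) => t; under [in X in _ -> X]eq_bigr do rewrite expr1.
have /filter_forall flowx : forall k : 'I_p, \forall t \near (0 : K),
    is_derive t (1 : K) (phi k ^~ x) (A k *m phi k t x).
  by move=> k; exact: (flow k x).2.
(* Differentiating at [t] requires the identity on a whole neighborhood of [t], hence the
   interior. *)
apply: filterS2 (nbhs_interior IHm) flowx => t vanish deriv.
apply/colP => i; rewrite mxE summxE.
have D1 : is_derive t (1 : K)
    (\sum_(k < p) (fun s => (A k ^+ m.+1 *m phi k s x) i 0 : K^o))
    (\sum_(k < p) (A k ^+ m.+1 *m (A k *m phi k t x)) i 0).
  by apply: is_derive_sum => k; apply: is_derive_mulmx.
have D0 : is_derive t (1 : K)
    (\sum_(k < p) (fun s => (A k ^+ m.+1 *m phi k s x) i 0 : K^o)) (0 : K^o).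
  apply: near_eq_is_derive (is_derive_cst (0 : K^o) t 1).
  apply: filterS vanish => s /matrixP/(_ i 0).
  by rewrite mxE summxE fct_sumE.
case: D1 => _; case: D0 => _ -> /esym sum0.
rewrite -[RHS]sum0; apply: eq_bigr => k _.
by rewrite mulmxA mulmxE -exprSr.
Qed.

(** The last nonzero iterate of [x] under [U] qualifies. Keeping its form [U ^+ a *m x] lets a
    relation between [U] and another matrix act on it. *)
Lemma nilpotent_kernel (F : fieldType) (n m p : nat) (U : 'M[F]_n)
    (x : 'M[F]_(n, p)) :
  U ^+ m = 0 -> x != 0 ->
  exists2 a : nat, U ^+ a *m x != 0 & U *m (U ^+ a *m x) = 0.
Proof.
move=> Um0 x0.
have ex0 : exists a, U ^+ a *m x == 0 by exists m; rewrite Um0 mul0mx.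
case: (ex_minnP ex0) => -[|a]; first by rewrite expr0 mul1mx (negPf x0).
rewrite exprS -mulmxE => /eqP Uax min_a; exists a; last by rewrite mulmxA.
by apply/negP => /min_a; rewrite ltnn.
Qed.

Lemma common_kernel (F : fieldType) (n m : nat) (U V : 'M[F]_n.+1) :
  U *m V = - (V *m U) -> U ^+ m = 0 -> V ^+ m = 0 ->
  exists2 x : 'cV[F]_n.+1, x != 0 & U *m x = 0 /\ V *m x = 0.
Proof.
move=> UV Um Vm.
have one0 : (const_mx 1 : 'cV[F]_n.+1) != 0.
  by apply/eqP => /colP/(_ 0)/eqP; rewrite !mxE oner_eq0.
have [a y0 Uy0] := nilpotent_kernel Um one0.
have [b x0 Vx0] := nilpotent_kernel Vm y0.
exists (V ^+ b *m (U ^+ a *m const_mx 1)) => //; split => //.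
(* Moving [U] past each factor [V] costs only a sign, until it meets a vector of its kernel. *)
elim: b {x0 Vx0} => [|b IHb]; first by rewrite expr0 mul1mx.
by rewrite exprS -mulmxE -mulmxA mulmxA UV mulNmx -mulmxA IHb mulmx0 oppr0.
Qed.

(** Carries nilpotency over to the quotient by a subspace of the kernel, where [M] is the induced
    map. *)
Lemma drsubmx_exp (F : fieldType) (n1 n2 m : nat) (u : 'M[F]_(n1, n2))
    (M : 'M[F]_n2) :
  drsubmx ((block_mx 0 u 0 M : 'M[F]_(n1 + n2)) ^+ m) = M ^+ m.
Proof.
suff [u' ->] : exists u', (block_mx (0 : 'M[F]_n1) u 0 M) ^+ m = block_mx (0 ^+ m) u' 0 (M ^+ m).
  by rewrite block_mxKdr.
elim: m => [|m [u' IHm]]; first by exists 0; rewrite !expr0 -scalar_mx_block.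
exists (u *m M ^+ m); rewrite !exprS IHm -mulmxE mulmx_block.
by rewrite !mul0mx !mulmx0 !mul0r !add0r.
Qed.

Lemma exp_conjmx (F : fieldType) (n m : nat) (g M : 'M[F]_n) :
  g \in unitmx -> (g *m M *m invmx g) ^+ m = g *m M ^+ m *m invmx g.
Proof.
move=> gU; elim: m => [|m IHm]; first by rewrite !expr0 mulmx1 mulmxV.
by rewrite !exprS IHm -!mulmxE !mulmxA mulmxKV.
Qed.

(** In a basis starting with a multiple of [x], a matrix killing [x] has zero first column. The
    choice of [g] depends on [x] alone, so it serves several matrices at once. *)
Lemma kernel_conj_block_mx (F : fieldType) (n : nat) (x : 'cV[F]_(1 + n)) :
  x != 0 -> exists2 g : 'M[F]_(1 + n), g \in unitmx &
  forall M : 'M[F]_(1 + n), M *m x = 0 ->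
    exists u : 'rV[F]_n, exists M' : 'M[F]_n, g *m M *m invmx g = block_mx 0 u 0 M'.
Proof.
move=> x0; set P := col_ebase x.
have PU : P \in unitmx := col_ebase_unit x.
exists (invmx P); first by rewrite unitmx_inv.
move=> M Mx; rewrite invmxK; set N := _ *m _ *m P.
suff Nl : lsubmx N = 0.
  exists (usubmx (rsubmx N)), (dsubmx (rsubmx N)).
  by rewrite block_mxEh vsubmxK col_mx0 -Nl hsubmxK.
have rk1 : \rank x = 1.
  by apply/eqP; rewrite eqn_leq rank_leq_col lt0n mxrank_eq0.
(* [row_ebase x] is an invertible 1 by 1 matrix, so the first column of [P] is a scalar multiple of
   [x]. *)
have xP : P *m pid_mx 1 = x *m invmx (row_ebase x).
  apply: (canRL (mulmxK (row_ebase_unit x))).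
  by rewrite -[RHS]mulmx_ebase rk1.
have <- : N *m (pid_mx 1 : 'M[F]_(1 + n, 1)) = 0.
  by rewrite /N -!mulmxA xP (mulmxA M) Mx mul0mx mulmx0.
by rewrite -[in RHS](hsubmxK N) pid_mx_col mul_row_col mulmx1 mulmx0 addr0.
Qed.

Lemma anticommuting_strictly_triangularizable (K : numFieldType) (n m : nat)
    (U V : 'M[K]_n) :
  U *m V = - (V *m U) -> U ^+ m = 0 -> V ^+ m = 0 ->
  exists2 g : 'M[K]_n, g \in unitmx &
    heisenberg (g *m U *m invmx g) /\ heisenberg (g *m V *m invmx g).
Proof.
elim: n U V => [|n IHn] U V UV Um Vm.
  by exists 1%:M; [exact: unitmx1 | split=> -[]].
have [x x0 [Ux Vx]] := common_kernel UV Um Vm.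
have [h hU hM] := kernel_conj_block_mx x0.
have [u [U' hUh]] := hM U Ux; have [v [V' hVh]] := hM V Vx.
have U'm : U' ^+ m = 0.
  by rewrite -(drsubmx_exp m u U') -hUh exp_conjmx // Um mulmx0 mul0mx /drsubmx !linear0.
have V'm : V' ^+ m = 0.
  by rewrite -(drsubmx_exp m v V') -hVh exp_conjmx // Vm mulmx0 mul0mx /drsubmx !linear0.
have UV' : U' *m V' = - (V' *m U').
  have : block_mx 0 u 0 U' *m block_mx 0 v 0 V'
      = - (block_mx 0 v 0 V' *m block_mx (0 : 'M[K]_1) u 0 U').
    rewrite -hUh -hVh !mulmxA !mulmxKV //; rewrite -(mulmxA h U) -(mulmxA h V) UV.
    by rewrite mulmxN mulNmx.
  rewrite !mulmx_block opp_block_mx => /eq_block_mx[_ _ _].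
  by rewrite !mul0mx !add0r.
have [g gU [gUg gVg]] := IHn U' V' UV' U'm V'm.
(* [e] keeps the kernel direction and applies to the remaining coordinates the conjugator [g] from
   the induction. *)
pose e : 'M[K]_(1 + n) := block_mx 1%:M 0 0 g.
pose e' : 'M[K]_(1 + n) := block_mx 1%:M 0 0 (invmx g).
have eh1 : (e *m h) *m (invmx h *m e') = 1%:M.
  rewrite mulmxA mulmxK // mulmx_block !mul0mx !mulmx0 !addr0 !add0r mulmx1.
  by rewrite mulmxV // -scalar_mx_block.
have [ehU _] := mulmx1_unit eh1.
have ehV : invmx (e *m h) = invmx h *m e' by rewrite -[RHS](mulKmx ehU) eh1 mulmx1.
have heis (w : 'rV[K]_n) (M : 'M[K]_n) (L : 'M[K]_(1 + n)) :
    h *m L *m invmx h = block_mx 0 w 0 M ->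
    heisenberg (g *m M *m invmx g) ->
    heisenberg (e *m h *m L *m invmx (e *m h)).
  move=> hLh gMg.
  have -> : e *m h *m L *m invmx (e *m h)
      = block_mx 0 (w *m invmx g) 0 (g *m M *m invmx g).
    rewrite ehV !mulmxA -2!(mulmxA e) hLh !mulmx_block.
    by rewrite !(mul0mx, mulmx0, mul1mx, add0r, addr0).
  move=> i j.
  case: (@split_ordP 1 n i) => i' ->; case: (@split_ordP 1 n j) => j' -> ji.
  - by rewrite block_mxEul mxE.
  - by move: ji; rewrite (ord1 i').
  - by rewrite block_mxEdl [LHS]mxE.
  - by rewrite block_mxEdr gMg.
exists (e *m h) => //; split; [exact: heis hUh gUg | exact: heis hVh gVg].
Qed.

Lemma anticommuting_cubes (K : numFieldType) (n : nat) (U V : 'M[K]_n) :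
  U * V = - (V * U) -> U ^+ 3 = V ^+ 3 -> V ^+ 4 = 0.
Proof.
move=> UV U3.
(* [V^4 = U^3 V = - V U^3 = - V^4]. *)
have swap k : U ^+ k * V = V * (- U) ^+ k.
  elim: k => [|k IHk]; first by rewrite !expr0 mulr1 mul1r.
  by rewrite exprSr -mulrA UV mulrN mulrA IHk [in RHS]exprSr mulrA mulrN.
have V4N : V ^+ 4 = - V ^+ 4.
  rewrite {1}exprSr -U3 swap exprNn -signr_odd expr1 mulN1r U3.
  by rewrite mulrN -exprS.
apply/matrixP => i j; rewrite [RHS]mxE; apply/eqP; move/matrixP/(_ i j): V4N.
by rewrite [RHS]mxE => /esym/eqP; rewrite eqNr.
Qed.

(* Up to scalars, [U] and [V] are the discrete Fourier components
   [A + w B + w^2 C] and [A + w^2 B + w C], with [w] a primitive cube root of 1. *)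
Lemma power_sums_anticommute (K : numFieldType) (n : nat) (A B C : 'M[K]_n) (w : K) :
  w ^+ 2 = - 1 - w ->
  A + B + C = 0 -> A ^+ 2 + B ^+ 2 + C ^+ 2 = 0 -> A ^+ 3 + B ^+ 3 + C ^+ 3 = 0 ->
  let U := A + (1 + w) *: B in let V := A - w *: B in
  [/\ U *m V = - (V *m U), U ^+ 4 = 0 & V ^+ 4 = 0].
Proof.
(* After substituting [C = - (A + B)], the Fourier components are [(1 - w^2) U] and [(1 - w) V]. *)
move=> w2 /(canRL (addKr _)) /[!addr0] -> S2 S3 U V.
(* Since [- w (1 + w) = 1], the sum [U V + V U] is exactly [A^2 + B^2 + C^2]. *)
have UV : U *m V = - (V *m U).
  apply/matrixP => i j; move/matrixP/(_ i j): S2; rewrite /U /V.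
  rewrite !expr2 -!mulmxE.
  rewrite !(mulmxDl, mulmxDr, mulNmx, mulmxN, =^~ scalemxAl, =^~ scalemxAr).
  (* Once the noncommutative words are opaque, each entry is an identity between scalars, within
     reach of [ring]. *)
  move: (A *m A) (A *m B) (B *m A) (B *m B) => AA AB BA BB; rewrite !mxE.
  move=> S2ij; have {S2ij}AB_ij : AB i j = - (AA i j + AA i j + BB i j + BB i j + BA i j).
    by apply: subr0_eq; rewrite -[RHS]S2ij; ring.
  ring: w2 AB_ij.
(* Here [U^3 - V^3 = - (1 + 2 w) (A^3 + B^3 + C^3)]. *)
have U3 : U ^+ 3 = V ^+ 3.
  apply/matrixP => i j; move/matrixP/(_ i j): S3; rewrite /U /V.
  rewrite !exprS !expr0 !mulr1 -!mulmxE.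
  rewrite !(mulmxDl, mulmxDr, mulNmx, mulmxN, =^~ scalemxAl, =^~ scalemxAr).
  rewrite !mulmxA.
  move: (A *m A *m A) (A *m A *m B) (A *m B *m A) (A *m B *m B) => AAA AAB ABA ABB.
  move: (B *m A *m A) (B *m A *m B) (B *m B *m A) (B *m B *m B) => BAA BAB BBA BBB.
  rewrite !mxE => S3ij.
  have {S3ij}AAB_ij : AAB i j = - (ABA i j + ABB i j + BAA i j + BAB i j + BBA i j).
    apply/eqP; rewrite -subr_eq0 -oppr_eq0; apply/eqP; rewrite -[RHS]S3ij; ring.
  ring: w2 AAB_ij.
rewrite !mulmxE in UV *.
have VU : V * U = - (U * V) by rewrite UV opprK.
split=> //; [exact: (anticommuting_cubes VU) | exact: (anticommuting_cubes UV)].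
Qed.

Lemma heisenberg_conj_lin (K : numFieldType) (n : nat) (g h M N : 'M[K]_n) (c : K) :
  heisenberg (g *m M *m h) -> heisenberg (g *m N *m h) ->
  heisenberg (g *m (c *: M + N) *m h).
Proof.
move=> hM hN i j ji.
rewrite mulmxDr mulmxDl -scalemxAr -scalemxAl mxE (hN _ _ ji) addr0.
by rewrite mxE (hM _ _ ji) mulr0.
Qed.

Theorem theorem5 (R : realType) (n : nat) (A : 'I_3 -> 'M[R[i]]_n)
    (A_distinct : injective A)
    (A_neq0 : forall k : 'I_3, A k <> 0)
    (A_bary : barycentric (fun k : 'I_3 => linear_field (A k))) :
  exists2 g : 'M[R[i]]_n, g \in unitmx &
    forall k : 'I_3, heisenberg (g *m A k *m invmx g).
Proof.
have [w w2] : exists w : R[i], w ^+ 2 = - 1 - w.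
  have [w] := @solve_monicpoly R[i] 2 (fun=> - 1) isT.
  rewrite !big_ord_recl big_ord0 /= expr0 expr1 mulr1 addr0 mulN1r => w2.
  by exists w.
have sums m := barycentric_linear_power_sum m A_bary.
move: (sums 0) (sums 1) (sums 2); rewrite !big_ord_recl !big_ord0 !addr0 !addrA !expr1.
set X := A _; set Y := A _; set Z := A _ => S1 S2 S3.
have [UV U4 V4] := power_sums_anticommute w2 S1 S2 S3.
have [g gU [gUg gVg]] := anticommuting_strictly_triangularizable UV U4 V4.
exists g => // k.
(* This is the determinant, up to sign, of the passage from [X], [Y] to the Fourier components. *)
have d0 : 1 + w + w != 0.
  have /eqP: (1 + w + w) ^+ 2 = - 3%:R by ring: w2.
  by apply: contraTneq => ->; rewrite expr0n eq_sym oppr_eq0 pnatr_eq0.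
have gXYg c d : heisenberg (g *m (c *: X + d *: Y) *m invmx g).
  set e := (1 + w + w)^-1.
  (* With [U], [V] the two components, [X = e (w U + (1 + w) V)] and [Y = e (U - V)]. The final
     [+ 0] gives the shape needed to apply [heisenberg_conj_lin] twice. *)
  have -> : c *: X + d *: Y = (c * (w * e) + d * e) *: (X + (1 + w) *: Y)
      + (c * ((1 + w) * e) - d * e) *: (X - w *: Y) + 0.
    by apply/matrixP => i j; rewrite !mxE /e; field.
  rewrite -addrA; apply: heisenberg_conj_lin => //.
  apply: heisenberg_conj_lin => //; rewrite mulmx0 mul0mx => i j _.
  exact: mxE.
have [c [d ->]] : exists c d, A k = c *: X + d *: Y.
  case: k => -[|[|[|//]]] k3.
  - by exists 1, 0; rewrite scale1r scale0r addr0; congr (A _); apply: val_inj.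
  - by exists 0, 1; rewrite scale1r scale0r add0r; congr (A _); apply: val_inj.
  - exists (- 1), (- 1); rewrite !scaleN1r -opprD.
    rewrite (_ : A _ = Z); first by apply/eqP; rewrite -addr_eq0 addrC S1.
    by congr (A _); apply: val_inj.
exact: gXYg.
Qed.
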